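(* Let $\Gamma$ be a discrete group with group von Neumann algebra $L(\Gamma)$. Then the following are equivalent: \begin{enumerate} \item $\Gamma$ is i.c.c. (every conjugacy class other than that of the identity is infinite), \item $L(\Gamma)$ is a factor, \item $\Delta_{\widehat\Gamma}^{(n)}(L(\Gamma))'\cap\underbrace{L(\Gamma)\mathbin{\bar\otimes}\cdots\mathbin{\bar\otimes}L(\Gamma)}_{n+1}=\mathbb C1$ for some $n\in\mathbb N$, \item $\Delta_{\widehat\Gamma}^{(n)}(L(\Gamma))'\cap\underbrace{L(\Gamma)\mathbin{\bar\otimes}\cdots\mathbin{\bar\otimes}L(\Gamma)}_{n+1}=\mathbb C1$ for all $n\in\mathbb N$. \end{enumerate}
   Context: $L(\Gamma)\subset B(\ell^2(\Gamma))$ is generated by the left regular representation $\{\lambda_t\mid t\in\Gamma\}$. The comultiplication $\Delta_{\widehat\Gamma}:L(\Gamma)\to L(\Gamma)\mathbin{\bar\otimes}L(\Gamma)$ is the unique normal unital $*$-homomorphism with $\lambda_t\mapsto\lambda_t\otimes\lambda_t$. $\Delta^{(1)}_{\widehat\Gamma}=\Delta_{\widehat\Gamma}$ and $\Delta_{\widehat\Gamma}^{(n+1)}=(\mathrm{id}^{\otimes n}\otimes\Delta_{\widehat\Gamma})\circ\Delta_{\widehat\Gamma}^{(n)}$, so $\Delta^{(n)}_{\widehat\Gamma}(\lambda_t)=\lambda_t^{\otimes(n+1)}$. $\mathbb N=\{1,2,\dots\}$. *)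

(* Defs.v *)
From HB Require Import structures.
From mathcomp Require Import all_boot all_order all_algebra.
From mathcomp Require Import complex ring lra.
From mathcomp Require Import all_classical all_reals ereal esum.

Set Implicit Arguments.
Unset Strict Implicit.
Unset Printing Implicit Defensive.

Import Order.TTheory GRing.Theory Num.Theory.

Local Open Scope classical_set_scope.
Local Open Scope ring_scope.
Local Open Scope complex_scope.

(** * The Hilbert space l^2(X) for an arbitrary index type X *)

Section SquareSummable.
Context {R : realType}.

(* |z|^2, as a real number *)
Definition sqmod (z : R[i]) : R := complex.Re z ^+ 2 + complex.Im z ^+ 2.

Definition square_summable (X : choiceType) : {pred X -> R[i]} :=
  fun f => (\esum_(x in setT) (sqmod (f x))%:E < +oo)%E.

Lemma sqmod_ge0 z : 0 <= sqmod z.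
Proof. by rewrite addr_ge0// sqr_ge0. Qed.

Lemma sqmodM z w : sqmod (z * w) = sqmod z * sqmod w.
Proof. by case: z w => [a b] [c d]; rewrite /sqmod /=; ring. Qed.

Lemma sqmodD_le z w : sqmod (z + w) <= 2 * sqmod z + 2 * sqmod w.
Proof.
case: z w => [a b] [c d]; rewrite /sqmod /=.
by have := sqr_ge0 (a - c); have := sqr_ge0 (b - d); nra.
Qed.

Lemma le_esumZl (X : choiceType) (c : R) (u : X -> R) :
  0 <= c -> (forall x, 0 <= u x) ->
  (\esum_(x in setT) (c * u x)%:E <= c%:E * \esum_(x in setT) (u x)%:E)%E.
Proof.
move=> c0 u0; apply: ge_ereal_sup => _ [A [finA _] <-].
under eq_fsbigr do rewrite EFinM.
rewrite -ge0_mule_fsumr; last by move=> x; rewrite lee_fin.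
rewrite lee_wpmul2l ?lee_fin//.
by apply: ereal_sup_ubound; exists A => //; split.
Qed.

Lemma square_summable_submod (X : choiceType) :
  submod_closed (@square_summable X).
Proof.
split=> [|c f g]; rewrite !unfold_in.
  rewrite esum1 ?ltry// => x _.
  by rewrite /sqmod /= expr0n /= addr0.
move=> ff gf.
have u0 (h : X -> R[i]) x : 0 <= sqmod (h x) by exact: sqmod_ge0.
have le1 : (\esum_(x in setT) (sqmod ((c *: f + g) x))%:E <=
   \esum_(x in setT) ((2 * sqmod c * sqmod (f x))%:E + (2 * sqmod (g x))%:E))%E.
  apply: le_esum => x _; rewrite -EFinD lee_fin.
  by rewrite (le_trans (sqmodD_le _ _))// sqmodM mulrA.
apply: (le_lt_trans le1).
rewrite esumD; last 2 first.
- by move=> x _; rewrite lee_fin !mulr_ge0 ?sqmod_ge0.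
- by move=> x _; rewrite lee_fin !mulr_ge0 ?sqmod_ge0.
apply: lte_add_pinfty.
  apply: (le_lt_trans (le_esumZl _ (u0 f))); first by rewrite mulr_ge0 ?sqmod_ge0.
  by apply: lte_mul_pinfty; rewrite ?lee_fin ?mulr_ge0 ?sqmod_ge0.
apply: (le_lt_trans (le_esumZl _ (u0 g))); first by [].
by apply: lte_mul_pinfty; rewrite ?lee_fin.
Qed.

End SquareSummable.

HB.instance Definition _ (R : realType) (X : choiceType) :=
  GRing.isSubmodClosed.Build R[i] (X -> R[i]) (@square_summable R X)
    (@square_summable_submod R X).

Record ell2 (R : realType) (X : choiceType) := Ell2 {
  ell2_fun :> X -> R[i];
  ell2_summable : ell2_fun \in @square_summable R X }.

HB.instance Definition _ (R : realType) (X : choiceType) :=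
  [isSub for @ell2_fun R X].
HB.instance Definition _ (R : realType) (X : choiceType) :=
  gen_eqMixin (ell2 R X).
HB.instance Definition _ (R : realType) (X : choiceType) :=
  gen_choiceMixin (ell2 R X).
HB.instance Definition _ (R : realType) (X : choiceType) :=
  [SubChoice_isSubLmodule of ell2 R X by <:].

Section HilbertSpace.
Context {R : realType}.

(* sum over X of an absolutely summable real family *)
Definition rsum (X : choiceType) (u : X -> R) : R :=
  fine (\esum_(x in setT) (Num.max (u x) 0)%:E)
  - fine (\esum_(x in setT) (Num.max (- u x) 0)%:E).

(* linear in the first variable *)
Definition ip (X : choiceType) (f g : ell2 R X) : R[i] :=
  rsum (fun x => complex.Re (f x * (g x)^*)) +i*
  rsum (fun x => complex.Im (f x * (g x)^*)).

Definition l2norm (X : choiceType) (f : ell2 R X) : R :=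
  Num.sqrt (fine (\esum_(x in setT) (sqmod (f x))%:E)).

(* l^2(X) (x) l^2(Y) is l^2(X * Y), with (f (x) g)(x, y) = f(x) g(y) *)
Lemma tens_summable (X Y : choiceType) (f : ell2 R X) (g : ell2 R Y) :
  (fun p : X * Y => f p.1 * g p.2) \in @square_summable R (X * Y)%type.
Proof.
have := ell2_summable f; have := ell2_summable g; rewrite !unfold_in => gf ff.
have := @esum_esum R X Y setT (fun=> setT)
  (fun x y => (sqmod (f x * g y))%:E).
rewrite (_ : _ `*`` _ = setT); last by apply/seteqP; split.
move=> <-; last by move=> x y; rewrite lee_fin sqmod_ge0.
have G0 : (0 <= \esum_(y in setT) (sqmod (g y))%:E)%E.
  by apply: esum_ge0 => y _; rewrite lee_fin sqmod_ge0.
have Gfin : (\esum_(y in setT) (sqmod (g y))%:E \is a fin_num)%E.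
  by rewrite ge0_fin_numE.
set c := fine (\esum_(y in setT) (sqmod (g y))%:E)%E.
have c0 : 0 <= c by exact: fine_ge0.
have le1 : (\esum_(x in setT) \esum_(y in setT) (sqmod (f x * g y))%:E <=
    \esum_(x in setT) (c * sqmod (f x))%:E)%E.
  apply: le_esum => x _; rewrite mulrC EFinM fineK//.
  under eq_esum do rewrite sqmodM.
  by apply: le_esumZl => [|y]; exact: sqmod_ge0.
apply: (le_lt_trans le1); apply: (le_lt_trans (le_esumZl c0 _)).
  by move=> x; exact: sqmod_ge0.
by apply: lte_mul_pinfty; rewrite ?lee_fin.
Qed.

Definition tens (X Y : choiceType) (f : ell2 R X) (g : ell2 R Y) :
  ell2 R (X * Y)%type := Ell2 (tens_summable f g).

End HilbertSpace.

(** * Bounded operators and von Neumann algebras *)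

Notation op R X := (ell2 R X -> ell2 R X).

Section Operators.
Context {R : realType}.

Definition bounded_op (X : choiceType) (T : op R X) : Prop :=
  linear T /\ exists c : R, forall f, l2norm (T f) <= c * l2norm f.

Definition is_adjoint (X : choiceType) (T T' : op R X) : Prop :=
  bounded_op T' /\ forall f g, ip (T f) g = ip f (T' g).

Definition commutant (X : choiceType) (S : set (op R X)) : set (op R X) :=
  [set T | bounded_op T /\ forall U, S U -> T \o U = U \o T].

(* Equality with the bicommutant already makes M a unital algebra of bounded
   operators, closed in the weak operator topology. *)
Definition von_neumann_algebra (X : choiceType) (M : set (op R X)) : Prop :=
  (forall T T', M T -> is_adjoint T T' -> M T') /\
  commutant (commutant M) = M.

Definition vN_generated (X : choiceType) (S : set (op R X)) : set (op R X) :=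
  \bigcap_(M in [set M | von_neumann_algebra M /\ S `<=` M]) M.

(* the operators C1 *)
Definition scalars (X : choiceType) : set (op R X) :=
  range (fun (c : R[i]) (f : ell2 R X) => c *: f).

Arguments scalars : clear implicits.

Definition is_factor (X : choiceType) (M : set (op R X)) : Prop :=
  von_neumann_algebra M /\ M `&` commutant M = scalars X.

(* U is the operator S (x) T on l^2(X) (x) l^2(Y) = l^2(X * Y) *)
Definition is_tensor_op (X Y : choiceType) (S : op R X) (T : op R Y)
    (U : op R (X * Y)%type) : Prop :=
  bounded_op U /\ forall f g, U (tens f g) = tens (S f) (T g).

Definition vN_tensor (X Y : choiceType) (M : set (op R X)) (N : set (op R Y)) :
    set (op R (X * Y)%type) :=
  vN_generated [set U | exists S T, [/\ M S, N T & is_tensor_op S T U]].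

(** * Normal unital *-homomorphisms *)

Definition positive_op (X : choiceType) (T : op R X) : Prop :=
  forall f, 0 <= ip (T f) f.

Definition op_le (X : choiceType) (S T : op R X) : Prop :=
  positive_op (T \- S).

Definition is_op_sup (X : choiceType) (D : set (op R X)) (S : op R X) : Prop :=
  [/\ bounded_op S, forall T, D T -> op_le T S &
      forall U, bounded_op U -> (forall T, D T -> op_le T U) -> op_le S U].

Definition directed (X : choiceType) (D : set (op R X)) : Prop :=
  D !=set0 /\
  forall S T, D S -> D T -> exists U, [/\ D U, op_le S U & op_le T U].

(* Phi preserves suprema of bounded upward directed sets of positive elements;
   these suprema may be computed among all bounded operators, since a von
   Neumann algebra contains them. *)
Definition normal_map (X Y : choiceType) (M : set (op R X))
    (Phi : op R X -> op R Y) : Prop :=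
  forall (D : set (op R X)) (S : op R X),
    D `<=` M `&` @positive_op X -> directed D -> is_op_sup D S ->
    is_op_sup (Phi @` D) (Phi S).

(* Phi restricts to a normal unital *-homomorphism from M to N; its values
   outside M are irrelevant. *)
Record normal_star_hom (X Y : choiceType) (M : set (op R X))
    (N : set (op R Y)) (Phi : op R X -> op R Y) : Prop := {
  star_hom_in : forall T, M T -> N (Phi T);
  star_hom1 : Phi id = id;
  star_homD : forall S T, M S -> M T -> Phi (S \+ T) = Phi S \+ Phi T;
  star_homZ : forall (c : R[i]) T, M T ->
    Phi (fun f => c *: T f) = (fun f => c *: Phi T f);
  star_homM : forall S T, M S -> M T -> Phi (S \o T) = Phi S \o Phi T;
  star_hom_adj : forall T T', M T -> is_adjoint T T' ->
    is_adjoint (Phi T) (Phi T');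
  star_hom_normal : normal_map M Phi }.

(* Psi is id (x) Phi : M (x) N -> M (x) P, the normal unital *-homomorphism
   with S (x) T |-> S (x) Phi(T). *)
Definition is_id_tensor (X Y Z : choiceType) (M : set (op R X))
    (N : set (op R Y)) (P : set (op R Z)) (Phi : op R Y -> op R Z)
    (Psi : op R (X * Y)%type -> op R (X * Z)%type) : Prop :=
  normal_star_hom (vN_tensor M N) (vN_tensor M P) Psi /\
  forall S T U, M S -> N T -> is_tensor_op S T U ->
    is_tensor_op S (Phi T) (Psi U).

End Operators.
Arguments scalars {R} X _.

(** * The group von Neumann algebra and its comultiplication *)

Definition icc (G : groupType) : Prop :=
  forall g : G, g != 1%g -> infinite_set (range (fun k => conjg g k)).

Section GroupVonNeumannAlgebra.
Context (R : realType) (G : groupType).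

Lemma translate_summable (t : G) (f : ell2 R G) :
  (fun s => f (t^-1 * s)%g) \in @square_summable R G.
Proof.
have := ell2_summable f; rewrite !unfold_in.
rewrite (reindex_esum setT setT (fun s => t^-1 * s)%g)//.
split=> // [s s' _ _ /mulgI//|s _].
by exists (t * s)%g => //; rewrite mulKg.
Qed.

Definition left_regular (t : G) : op R G :=
  fun f => Ell2 (translate_summable t f).

Definition group_vN : set (op R G) := vN_generated (range left_regular).

(* G ^ n.+1 and the (n.+1)-fold tensor power of L(G), acting on l^2(G ^ n.+1) *)
Fixpoint group_pow (n : nat) : choiceType :=
  if n is m.+1 then (G * group_pow m)%type else G.

Fixpoint group_vN_pow (n : nat) : set (op R (group_pow n)) :=
  match n return set (op R (group_pow n)) with
  | 0%N => group_vN
  | m.+1 => vN_tensor group_vN (@group_vN_pow m)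
  end.
Arguments group_vN_pow : clear implicits.

Definition is_comultiplication (Delta : op R G -> op R (G * G)%type) : Prop :=
  normal_star_hom group_vN (vN_tensor group_vN group_vN) Delta /\
  forall t, is_tensor_op (left_regular t) (left_regular t)
              (Delta (left_regular t)).

(* Amp n is id^{(x) n} (x) Delta, where id^{(x) n.+1} (x) Delta is
   id (x) (id^{(x) n} (x) Delta). *)
Definition is_amplification (Delta : op R G -> op R (G * G)%type)
    (Amp : forall n, op R (group_pow n) -> op R (group_pow n.+1)) : Prop :=
  Amp 0%N = Delta /\
  forall n, is_id_tensor group_vN (group_vN_pow n) (group_vN_pow n.+1)
              (Amp n) (Amp n.+1).

(* Delta^(n), with Delta^(0) = id; in particular Delta^(1) = Amp 0. *)
Fixpoint iter_comult
    (Amp : forall n, op R (group_pow n) -> op R (group_pow n.+1))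
    (n : nat) : op R G -> op R (group_pow n) :=
  match n return op R G -> op R (group_pow n) with
  | 0%N => id
  | m.+1 => Amp m \o @iter_comult Amp m
  end.
Arguments iter_comult : clear implicits.

(* Delta^(n)(L(G))' /\ L(G)^{(x) n.+1} *)
Definition comult_commutant
    (Amp : forall n, op R (group_pow n) -> op R (group_pow n.+1))
    (n : nat) : set (op R (group_pow n)) :=
  commutant (iter_comult Amp n @` group_vN) `&` group_vN_pow n.

End GroupVonNeumannAlgebra.
Arguments group_vN R G _ : clear implicits.
Arguments comult_commutant {R G} Amp n _.

(* Main.v *)
(** By construction L(G)^{(x) n+1} commutes with the right translations of
    G^{n+1}, so an element T of it is determined by the vector T delta_1.  If T
    also commutes with Delta^(n)(lambda_t), which is the left translation by the
    diagonal element (t, ..., t), then T delta_1 is constant on the orbits of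
    the diagonal conjugation action of G.  If G is i.c.c. all orbits but {1} are
    infinite, hence T delta_1 is a multiple of delta_1 and T is a scalar.
    Conversely, if C is a finite nontrivial conjugacy class, the sum z of the
    lambda_c over c in C is central in L(G), so Delta^(n)(z) commutes with
    Delta^(n)(L(G)); it sends delta_1 to the indicator function of the diagonal
    copy of C and is not a scalar.  Factoriality is the case n = 0. *)
Require Import Defs.
From mathcomp Require Import all_boot all_order all_algebra.
From mathcomp Require Import finmap complex.
From mathcomp Require Import all_classical all_reals ereal esum.

Set Implicit Arguments.
Unset Strict Implicit.
Unset Printing Implicit Defensive.

Import Order.TTheory GRing.Theory Num.Theory.

Local Open Scope classical_set_scope.
Local Open Scope ring_scope.
Local Open Scope complex_scope.

(** * Squared norms and boundedness on l^2(X) *)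

Section SquareNorm.
Context {R : realType}.
Implicit Types (X : choiceType) (z w : R[i]).

Lemma sqmod0 : sqmod (0 : R[i]) = 0.
Proof. by rewrite /sqmod /= expr0n /= addr0. Qed.

Lemma sqmod_eq0 z : sqmod z = 0 -> z = 0.
Proof.
case: z => a b /eqP; rewrite /sqmod /= paddr_eq0 ?sqr_ge0// !sqrf_eq0.
by move=> /andP[/eqP-> /eqP->].
Qed.

Lemma esum_supp1 X (a : X -> \bar R) x : (0 <= a x)%E ->
  (forall y, y != x -> a y = 0%E) -> \esum_(y in setT) a y = a x.
Proof.
move=> ax0 a0; rewrite -(esum_set1 ax0) [RHS]esum_mkcond.
apply: eq_esum => y _; case: ifPn => // /negP yx; apply: a0.
by apply/negP => /eqP exy; apply: yx; rewrite inE.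
Qed.

Lemma ell2P X (f g : ell2 R X) : (forall x, f x = g x) -> f = g.
Proof. by move=> fg; apply: val_inj; apply/funext. Qed.

Lemma ell2D X (f g : ell2 R X) x : (f + g) x = f x + g x.
Proof. by []. Qed.

Lemma ell2B X (f g : ell2 R X) x : (f - g) x = f x - g x.
Proof. by []. Qed.

Lemma ell2Z X c (f : ell2 R X) x : (c *: f) x = c * f x.
Proof. by []. Qed.

Lemma ell20 X x : (0 : ell2 R X) x = 0.
Proof. by []. Qed.

Lemma ell2_sum X (I : Type) (s : seq I) (F : I -> ell2 R X) x :
  (\sum_(i <- s) F i) x = \sum_(i <- s) F i x.
Proof.
by elim/big_rec2: _ => [|i a b _ <-]; rewrite ?ell20 ?ell2D.
Qed.

Definition normsq X (f : ell2 R X) : R :=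
  fine (\esum_(x in setT) (sqmod (f x))%:E).

Lemma esum_sqmod_ge0 X (A : set X) (f : X -> R[i]) :
  (0 <= \esum_(x in A) (sqmod (f x))%:E)%E.
Proof. by apply: esum_ge0 => x _; rewrite lee_fin sqmod_ge0. Qed.

Lemma normsq_ge0 X (f : ell2 R X) : 0 <= normsq f.
Proof. exact/fine_ge0/esum_sqmod_ge0. Qed.

Lemma normsqE X (f : ell2 R X) :
  (normsq f)%:E = \esum_(x in setT) (sqmod (f x))%:E.
Proof.
rewrite fineK// ge0_fin_numE ?esum_sqmod_ge0//.
by have := ell2_summable f; rewrite unfold_in.
Qed.

Lemma sqmod_le_normsq X (f : ell2 R X) x : sqmod (f x) <= normsq f.
Proof.
rewrite -lee_fin normsqE; apply: esum_ge; exists [set x].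
  by split; [exact: finite_set1|].
by rewrite fsbig_set1.
Qed.

Lemma normsq_le X (f : ell2 R X) c :
  (\esum_(x in setT) (sqmod (f x))%:E <= c%:E)%E -> normsq f <= c.
Proof. by rewrite -lee_fin normsqE. Qed.

(** Termwise from [sqmodD_le]; the factor 2 stands in for the triangle inequality and is harmless
    for boundedness. *)
Lemma normsqD X (f g : ell2 R X) :
  normsq (f + g) <= 2 * normsq f + 2 * normsq g.
Proof.
apply: normsq_le.
apply: (@le_trans _ _ (\esum_(x in setT) ((2 * sqmod (f x))%:E
   + (2 * sqmod (g x))%:E))%E).
  by apply: le_esum => x _; rewrite -EFinD lee_fin ell2D sqmodD_le.
rewrite esumD; try by move=> x _; rewrite lee_fin mulr_ge0 ?sqmod_ge0.
by rewrite EFinD !EFinM !normsqE leeD// le_esumZl// => x; exact: sqmod_ge0.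
Qed.

Lemma normsqZ X c (f : ell2 R X) : normsq (c *: f) <= sqmod c * normsq f.
Proof.
apply: normsq_le; rewrite EFinM normsqE.
under eq_esum do rewrite ell2Z sqmodM.
by apply: le_esumZl => [|x]; exact: sqmod_ge0.
Qed.

(** A bound c on norms becomes c^2 on squared norms, and the way back takes a square root.
    Boundedness can then be handled on sums of [sqmod], with a nonnegative constant. *)
Lemma bounded_opP X (T : op R X) : bounded_op T <->
  linear T /\ exists2 c, 0 <= c & forall f, normsq (T f) <= c * normsq f.
Proof.
have l2E f : l2norm f = Num.sqrt (normsq f) by [].
split=> -[lT [c]].
- move=> cT; split=> //; exists (c ^+ 2); first exact: sqr_ge0.
  move=> f; have := cT f; rewrite !l2E => le.
  rewrite -[leLHS]sqr_sqrtr ?normsq_ge0// -[X in _ <= _ * X]sqr_sqrtr ?normsq_ge0//.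
  rewrite -exprMn lerXn2r ?nnegrE ?sqrtr_ge0//.
  exact: le_trans le.
- move=> c0 cT; split=> //; exists (Num.sqrt c) => f.
  by rewrite !l2E -sqrtrM// ler_wsqrtr.
Qed.

End SquareNorm.

(** * Point masses and density of their span *)

Section Delta.
Context {R : realType}.
Implicit Types (X Y : choiceType).

Lemma delta_summable X (x : X) :
  (fun y => (y == x)%:R : R[i]) \in @square_summable R X.
Proof.
rewrite unfold_in (@esum_supp1 _ _ _ x) ?ltry ?lee_fin ?sqmod_ge0//.
by move=> y /negbTE->; rewrite sqmod0.
Qed.

Definition delta X (x : X) : ell2 R X := Ell2 (delta_summable x).

Lemma deltaE X (x y : X) : delta x y = (y == x)%:R.
Proof. by []. Qed.

Lemma tens_delta X Y (x : X) (y : Y) : tens (delta x) (delta y) = delta (x, y).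
Proof.
apply: ell2P => -[x' y']; rewrite /= xpair_eqE.
by case: (x' == x); case: (y' == y); rewrite ?mulr0 ?mul0r ?mulr1.
Qed.

(** The sum of the |f(x)|^2 is a supremum over finite sets, so some finite A comes within e of it;
    subtracting the part of f on A leaves only the mass off A. *)
Lemma normsq_tail_lt X (f : ell2 R X) (e : R) : 0 < e ->
  exists s : seq X, normsq (f - \sum_(x <- s) f x *: delta x) < e.
Proof.
move=> e0; have fin : \esum_(x in setT) (sqmod (f x))%:E \is a fin_num.
  by rewrite -normsqE.
have [_ [A [finA _] <-] lt] := ub_ereal_sup_adherent e0 fin.
exists (fset_set A); rewrite -lte_fin normsqE.
rewrite (_ : \esum_(x in _) _ = \esum_(x in setT `&` ~` A) (sqmod (f x))%:E).
  move: lt; rewrite -/(esum _ _) (esumID A) => [|x _]; last first.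
    by rewrite lee_fin sqmod_ge0.
  rewrite setTI esum_fset// => [|x _]; last by rewrite lee_fin sqmod_ge0.
  rewrite fsbig_finite//= sumEFin setTI.
  (* The mass off A must be known finite before the inequality can be rearranged as one between
     reals. *)
  have [n ->] : exists n, \esum_(x in ~` A) (sqmod (f x))%:E = n%:E.
    exists (fine (\esum_(x in ~` A) (sqmod (f x))%:E)); rewrite fineK//.
    rewrite ge0_fin_numE ?esum_sqmod_ge0//.
    apply: (le_lt_trans _ (_ : (normsq f)%:E < +oo)%E); last exact: ltry.
    rewrite normsqE [leRHS](esumID A) => [|x _]; last by rewrite lee_fin sqmod_ge0.
    by rewrite !setTI leeDr// esum_sqmod_ge0.
  by rewrite -EFinD !lte_fin ltrBlDr ltrD2l.
rewrite setTI [RHS]esum_mkcond; apply: eq_esum => y _.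
rewrite ell2B ell2_sum; under eq_bigr do rewrite ell2Z deltaE.
(* Off A the finite sum vanishes at y; on A its only nonzero term is f y. *)
case: ifPn => yA.
  rewrite big1_seq ?subr0// => x /= xA; case: eqP => [yx|_]; last by rewrite mulr0.
  by move/set_mem: yA => []; move: xA; rewrite -yx in_fset_set// => /set_mem.
have {}yA : y \in fset_set A by move: yA; rewrite in_fset_set// in_setC negbK.
rewrite (big_rem y)//= eqxx mulr1 big1_seq ?addr0 ?subrr ?sqmod0// => x /=.
by rewrite mem_rem_uniq ?fset_uniq// inE eq_sym => /andP[/negbTE-> _]; rewrite mulr0.
Qed.

Lemma bounded_opD X (S T : op R X) :
  bounded_op S -> bounded_op T -> bounded_op (S \+ T).
Proof.
move=> /bounded_opP[lS [c c0 Sc]] /bounded_opP[lT [d d0 Td]]; apply/bounded_opP.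
split=> [k f g /=|]; first by rewrite lS lT scalerDr addrACA.
exists (2 * c + 2 * d) => [|f /=]; first by rewrite addr_ge0// mulr_ge0.
by rewrite (le_trans (normsqD _ _))// [leRHS]mulrDl -!mulrA lerD// ler_wpM2l.
Qed.

Lemma bounded_opZ X k (T : op R X) :
  bounded_op T -> bounded_op (fun f => k *: T f).
Proof.
move=> /bounded_opP[lT [c c0 Tc]]; apply/bounded_opP; split.
  by move=> a f g /=; rewrite lT scalerDr !scalerA mulrC.
exists (sqmod k * c) => [|f]; first by rewrite mulr_ge0 ?sqmod_ge0.
by rewrite (le_trans (normsqZ _ _))// -mulrA ler_wpM2l ?sqmod_ge0.
Qed.

Lemma bounded_op_id X : bounded_op (id : op R X).
Proof.
by apply/bounded_opP; split=> //; exists 1 => // f; rewrite mul1r.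
Qed.

Lemma bounded_op_comp X (S T : op R X) :
  bounded_op S -> bounded_op T -> bounded_op (S \o T).
Proof.
move=> /bounded_opP[lS [c c0 Sc]] /bounded_opP[lT [d d0 Td]]; apply/bounded_opP.
split=> [k f g /=|]; first by rewrite lT lS.
exists (c * d) => [|f /=]; first exact: mulr_ge0.
by rewrite (le_trans (Sc _))// -mulrA ler_wpM2l.
Qed.

Lemma linear_op0 X (T : op R X) : linear T -> T 0 = 0.
Proof. by move=> lT; have := lT (-1) 0 0; rewrite scaler0 addr0 scaleN1r addNr. Qed.

Lemma linear_opD X (T : op R X) f g : linear T -> T (f + g) = T f + T g.
Proof. by move=> lT; have := lT 1 f g; rewrite !scale1r. Qed.

Lemma linear_opZ X (T : op R X) k f : linear T -> T (k *: f) = k *: T f.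
Proof. by move=> lT; have := lT k f 0; rewrite (linear_op0 lT) !addr0. Qed.

Lemma linear_op_sum X (T : op R X) (I : Type) (s : seq I) (F : I -> ell2 R X) :
  linear T -> T (\sum_(i <- s) F i) = \sum_(i <- s) T (F i).
Proof.
move=> lT; elim/big_rec2: _ => [|i a b _ <-]; first exact: linear_op0.
exact: linear_opD.
Qed.

(** Finitely supported vectors are dense by [normsq_tail_lt], and the bounded operator S - T
    vanishes on them. *)
Lemma bounded_op_eq X (S T : op R X) : bounded_op S -> bounded_op T ->
  (forall x, S (delta x) = T (delta x)) -> S = T.
Proof.
move=> bS bT ST; pose D : op R X := S \+ (fun f => -1 *: T f).
have /bounded_opP[lD [c c0 Dc]] : bounded_op D.
  by apply: bounded_opD => //; exact: bounded_opZ.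
have D0 x : D (delta x) = 0 by rewrite /D /= ST scaleN1r subrr.
suff DE f : D f = 0.
  by apply/funext => f; apply/subr0_eq; rewrite -[RHS](DE f) /D /= scaleN1r.
apply: ell2P => y; rewrite ell20; apply: sqmod_eq0.
apply/eqP; rewrite eq_le sqmod_ge0 andbT; apply/ler_addgt0Pr => e e0; rewrite add0r.
(* Dividing by c + 1 rather than c covers c = 0. *)
have e'0 : 0 < e / (c + 1) by rewrite divr_gt0// ltr_wpDl.
have [s lts] := normsq_tail_lt f e'0.
set g := (X in normsq X) in lts.
have -> : D f = D g.
  rewrite /g -scaleN1r addrC lD (linear_op_sum _ _ lD) big1 ?scaler0 ?add0r// => x _.
  by rewrite (linear_opZ _ _ lD) D0 scaler0.
rewrite (le_trans (sqmod_le_normsq _ _))// (le_trans (Dc _))//.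
apply: (@le_trans _ _ (c * (e / (c + 1)))); first by rewrite ler_wpM2l// ltW.
rewrite mulrA ler_pdivrMr ?ltr_wpDl// mulrC ler_wpM2l//; first exact: ltW.
by rewrite lerDl.
Qed.

End Delta.

(** * Permutation operators and adjoints *)

Section Precomposition.
Context {R : realType}.
Implicit Types (X Y : choiceType).

Lemma esum_bij X (s : X -> X) (a : X -> \bar R) : bijective s ->
  \esum_(x in setT) a (s x) = \esum_(x in setT) a x.
Proof.
by move=> bs; rewrite [RHS](reindex_esum setT setT s)// setTT_bijective.
Qed.

Lemma precomp_summable X (s : X -> X) (f : ell2 R X) : bijective s ->
  (fun x => f (s x)) \in @square_summable R X.
Proof.
move=> bs; have := ell2_summable f; rewrite !unfold_in.
by rewrite (esum_bij (fun x => (sqmod (f x))%:E) bs).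
Qed.

(** The unitary that permutes the point masses by the inverse of s; left and right translations are
    both of this form. *)
Definition precomp X (s : X -> X) (bs : bijective s) : op R X :=
  fun f => Ell2 (precomp_summable f bs).

Lemma precompE X (s : X -> X) (bs : bijective s) f x : precomp bs f x = f (s x).
Proof. by []. Qed.

Lemma bounded_precomp X (s : X -> X) (bs : bijective s) :
  bounded_op (precomp bs).
Proof.
apply/bounded_opP; split=> [k f g|].
  exact: ell2P.
exists 1 => // f; rewrite mul1r; apply: normsq_le; rewrite normsqE.
by rewrite (esum_bij (fun x => (sqmod (f x))%:E) bs).
Qed.

Lemma precomp_delta X (s s' : X -> X) (bs : bijective s) x :
  cancel s s' -> cancel s' s -> precomp bs (delta x) = delta (s' x).
Proof.
by move=> sK s'K; apply: ell2P => y; rewrite precompE !deltaE (can2_eq sK s'K).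
Qed.

Lemma rsum_supp1 X (u : X -> R) x : (forall y, y != x -> u y = 0) ->
  rsum u = u x.
Proof.
move=> u0; rewrite /rsum !(@esum_supp1 _ _ _ x) /=.
- by case: (leP (u x) 0) => [u_le0|/ltW u_ge0];
    [rewrite max_l ?oppr_ge0// sub0r opprK | rewrite max_r ?oppr_le0// subr0].
- by rewrite lee_fin le_max lexx orbT.
- by move=> y /u0->; rewrite oppr0 maxxx.
- by rewrite lee_fin le_max lexx orbT.
- by move=> y /u0->; rewrite maxxx.
Qed.

Lemma ip_deltal X (g : ell2 R X) x : ip (delta x) g = (g x)^*.
Proof.
rewrite /ip !(@rsum_supp1 _ _ x).
- by rewrite deltaE eqxx mul1r; case: (g x).
- by move=> y /negbTE yx; rewrite deltaE yx mul0r.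
- by move=> y /negbTE yx; rewrite deltaE yx mul0r.
Qed.

Lemma ip_deltar X (f : ell2 R X) y : ip f (delta y) = f y.
Proof.
rewrite /ip !(@rsum_supp1 _ _ y).
- by rewrite deltaE eqxx mulr1n rmorph1 mulr1; case: (f y).
- by move=> x /negbTE xy; rewrite deltaE xy mulr0n rmorph0 mulr0.
- by move=> x /negbTE xy; rewrite deltaE xy mulr0n rmorph0 mulr0.
Qed.

Lemma adjoint_coef X (T T' : op R X) x y : is_adjoint T T' ->
  T' (delta y) x = (T (delta x) y)^*.
Proof.
move=> [_ /(_ (delta x) (delta y))]; rewrite ip_deltal ip_deltar => ->.
by rewrite conjcK.
Qed.

Lemma adjoint_comm_precomp X (T T' : op R X) s (bs : bijective s) :
  is_adjoint T T' -> T \o precomp bs = precomp bs \o T ->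
  T' \o precomp bs = precomp bs \o T'.
Proof.
move=> adjT TU; have [bT' _] := adjT; have bU := bounded_precomp bs.
apply: bounded_op_eq => [||y]; try exact: bounded_op_comp.
have [s' sK s'K] := bs; apply: ell2P => x /=.
rewrite (precomp_delta _ _ sK s'K) !(adjoint_coef _ _ adjT); congr (_^*).
(* Column s x, row s' y of the commutation relation: matrix entries of T are unchanged when both
   indices are moved by s. *)
have /(congr1 (fun V : op R X => V (delta (s x)) (s' y))) := TU.
by rewrite /= (precomp_delta _ _ sK s'K) sK s'K.
Qed.

End Precomposition.

(** * Commutants and generated von Neumann algebras *)

Section VonNeumann.
Context {R : realType}.
Implicit Types (X Y : choiceType).

Lemma commutant_anti X (S S' : set (op R X)) :
  S `<=` S' -> commutant S' `<=` commutant S.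
Proof. by move=> SS' T [bT TS']; split=> // U /SS'; exact: TS'. Qed.

Lemma sub_bicommutant X (S : set (op R X)) : S `<=` @bounded_op R X ->
  S `<=` commutant (commutant S).
Proof. by move=> bS T ST; split=> [|U [_ US]]; [exact: bS | rewrite US]. Qed.

Lemma commutant_bounded X (S : set (op R X)) : commutant S `<=` @bounded_op R X.
Proof. by move=> T []. Qed.

Lemma tricommutant X (S : set (op R X)) : S `<=` @bounded_op R X ->
  commutant (commutant (commutant S)) = commutant S.
Proof.
move=> bS; apply/seteqP; split; first exact/commutant_anti/sub_bicommutant.
exact/sub_bicommutant/commutant_bounded.
Qed.

(* The commutant is closed under adjoints because the matrix coefficients of a
   bounded operator commuting with a permutation operator are invariant under
   the permutation. *)
Lemma precomp_commutant_vN X (S : set (op R X)) :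
  (forall U, S U -> exists s (bs : bijective s), U = precomp bs) ->
  von_neumann_algebra (commutant S).
Proof.
move=> Sp; split; last first.
  by apply: tricommutant => _ /Sp[s [bs ->]]; exact: bounded_precomp.
move=> T T' [bT TS] adjT; split; first by case: adjT.
move=> U SU; have [s [bs eU]] := Sp _ SU; move: (TS _ SU); rewrite eU.
exact: adjoint_comm_precomp.
Qed.

Lemma vN_bounded X (M : set (op R X)) : von_neumann_algebra M ->
  M `<=` @bounded_op R X.
Proof. by move=> [_ <-]; exact: commutant_bounded. Qed.

Lemma vN_scalars X (M : set (op R X)) : von_neumann_algebra M ->
  scalars X `<=` M.
Proof.
move=> [_ <-] _ [k _ <-]; split; first exact/bounded_opZ/bounded_op_id.
by move=> U [[lU _] _]; apply/funext => f /=; rewrite linear_opZ.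
Qed.

Lemma vN_add X (M : set (op R X)) S T : von_neumann_algebra M ->
  M S -> M T -> M (S \+ T).
Proof.
move=> [_ <-] [bS Sc] [bT Tc]; split; first exact: bounded_opD.
move=> U cU; apply/funext => f; have [[lU _] _] := cU; rewrite /= (linear_opD _ _ lU).
by congr (_ + _); [have := Sc _ cU | have := Tc _ cU];
  move/(congr1 (fun V : op R X => V f)).
Qed.

Lemma vN_generated_sub X (S M : set (op R X)) : von_neumann_algebra M ->
  S `<=` M -> vN_generated S `<=` M.
Proof. by move=> vM SM T; apply. Qed.

Lemma sub_vN_generated X (S : set (op R X)) : S `<=` vN_generated S.
Proof. by move=> T ST M [_]; apply. Qed.

(* The algebra M only ensures that S consists of bounded operators. *)
Lemma vN_generated_vN X (S M : set (op R X)) : von_neumann_algebra M ->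
  S `<=` M -> von_neumann_algebra (vN_generated S).
Proof.
move=> vM SM; split=> [T T' ST adjT N [vN SN]|].
  by case: (vN) => + _; apply; [exact: ST | ].
apply/seteqP; split=> [T TS N [vN SN]|].
  have [_ <-] := vN; have := TS; apply: commutant_anti; apply: commutant_anti.
  exact: vN_generated_sub.
apply: sub_bicommutant.
exact: subset_trans (vN_generated_sub vM SM) (vN_bounded vM).
Qed.

(** Both sides are compared on [delta (x, y)], the tensor of [delta x] and [delta y], where the
    product permutation acts leg by leg. *)
Lemma tensor_comm_precomp X Y (S : op R X) (T : op R Y) U s t st
    (bs : bijective s) (bt : bijective t) (bst : bijective st) :
  (forall p, st p = (s p.1, t p.2)) -> is_tensor_op S T U ->
  S \o precomp bs = precomp bs \o S -> T \o precomp bt = precomp bt \o T ->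
  U \o precomp bst = precomp bst \o U.
Proof.
move=> stE [bU UE] Ss Tt; have bP := bounded_precomp bst.
apply: bounded_op_eq => [||[x y]]; try exact: bounded_op_comp.
have PE (f : ell2 R X) (g : ell2 R Y) :
    precomp bst (tens f g) = tens (precomp bs f) (precomp bt g).
  by apply: ell2P => p; rewrite precompE /= stE.
rewrite -tens_delta /= PE !UE PE.
by congr tens; [move/(congr1 (fun V : op R X => V (delta x))): Ss
  | move/(congr1 (fun V : op R Y => V (delta y))): Tt].
Qed.

End VonNeumann.

(** * The group G^(n+1) and diagonal conjugation *)

Section PowerGroup.
Variable G : groupType.

(** [group_pow] is only a choice type, so the group law of G^(n+1) is built by hand,
    coordinatewise. *)
Fixpoint pow_mul n : group_pow G n -> group_pow G n -> group_pow G n :=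
  match n with
  | 0 => fun x y => (x * y)%g
  | m.+1 => fun x y => ((x.1 * y.1)%g, pow_mul x.2 y.2)
  end.

Fixpoint pow_inv n : group_pow G n -> group_pow G n :=
  match n with
  | 0 => fun x => (x^-1)%g
  | m.+1 => fun x => ((x.1^-1)%g, pow_inv x.2)
  end.

Fixpoint pow_diag n (t : G) : group_pow G n :=
  match n with
  | 0 => t
  | m.+1 => (t, pow_diag m t)
  end.

Lemma pow_mul1 n (x : group_pow G n) : pow_mul (pow_diag n 1%g) x = x.
Proof. by elim: n x => [x|n IH [x y]]; rewrite /= ?IH ?mul1g. Qed.

Lemma pow_mulKV n (y x : group_pow G n) : pow_mul (pow_mul x y) (pow_inv y) = x.
Proof. by elim: n x y => [x y|n IH [x x'] [y y']]; rewrite /= ?IH ?mulgK. Qed.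

Lemma pow_mulVK n (y x : group_pow G n) : pow_mul (pow_mul x (pow_inv y)) y = x.
Proof. by elim: n x y => [x y|n IH [x x'] [y y']]; rewrite /= ?IH ?mulgVK. Qed.

Lemma pow_invK n (x : group_pow G n) : pow_inv (pow_inv x) = x.
Proof. by elim: n x => [x|n IH [x y]]; rewrite /= ?IH ?invgK. Qed.

Lemma pow_diagVK n t (x : group_pow G n) :
  pow_mul (pow_diag n t^-1%g) (pow_mul (pow_diag n t) x) = x.
Proof. by elim: n x => [x|n IH [x y]]; rewrite /= ?IH ?mulKg. Qed.

Lemma pow_diagKV n t (x : group_pow G n) :
  pow_mul (pow_diag n t) (pow_mul (pow_diag n t^-1%g) x) = x.
Proof. by elim: n x => [x|n IH [x y]]; rewrite /= ?IH ?mulVKg. Qed.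

Lemma pow_diag_inv n t : pow_inv (pow_diag n t) = pow_diag n t^-1%g.
Proof. by elim: n => //= n ->. Qed.

Lemma pow_diagM n s t :
  pow_mul (pow_diag n s) (pow_diag n t) = pow_diag n (s * t)%g.
Proof. by elim: n => //= n ->. Qed.

Lemma pow_diag_inj n : injective (pow_diag n).
Proof. by case: n => [|n] s t // []. Qed.

Lemma pow_rmul_bij n (h : group_pow G n) : bijective (fun x => pow_mul x h).
Proof.
by exists (fun x => pow_mul x (pow_inv h)) => x; rewrite ?pow_mulKV ?pow_mulVK.
Qed.

Lemma pow_diag_bij n t : bijective (pow_mul (pow_diag n t)).
Proof.
exists (pow_mul (pow_diag n t^-1%g)) => x; [exact: pow_diagVK | exact: pow_diagKV].
Qed.

Definition diag_conj n (x : group_pow G n) t : group_pow G n :=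
  pow_mul (pow_mul (pow_diag n t^-1%g) x) (pow_diag n t).

(** p is the projection to a nontrivial coordinate; coordinate projections intertwine diagonal
    conjugation with conjugation in G. *)
Lemma diag_conj_coord n (x : group_pow G n) : x != pow_diag n 1%g ->
  exists2 p : group_pow G n -> G, p x != 1%g &
    forall t, p (diag_conj x t) = conjg (p x) t.
Proof.
elim: n x => [x x1|n IH [x y]].
  by exists id => // t; rewrite /diag_conj /= conjgE mulgA.
rewrite /= xpair_eqE negb_and => /orP[x1|/IH[p p1 pJ]].
  by exists fst => // t; rewrite /= conjgE mulgA.
by exists (p \o snd) => // t; rewrite /= -pJ.
Qed.

(** The projection from [diag_conj_coord] carries the orbit onto the class of a nontrivial element,
    infinite by i.c.c., while a finite set has finite image. *)
Lemma icc_diag_conj_infinite n (x : group_pow G n) : icc G ->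
  x != pow_diag n 1%g -> infinite_set (range (diag_conj x)).
Proof.
move=> iccG /diag_conj_coord[p /iccG inf pJ] /(finite_image p); apply: contra_not inf.
by apply: sub_finite_set => _ [t _ <-]; exists (diag_conj x t) => //; exists t.
Qed.

End PowerGroup.

(** * Tensor powers of L(G), translations and class sums *)

Section GroupAlgebra.
Context {R : realType} {G : groupType}.

Definition right_translation n (h : group_pow G n) : op R (group_pow G n) :=
  precomp (pow_rmul_bij h).

(** The inverse makes it send [delta x] to the point mass at (t, ..., t) x, as expected of
    Delta^(n)(lambda_t). *)
Definition diag_translation n t : op R (group_pow G n) :=
  precomp (pow_diag_bij n t^-1%g).
Arguments diag_translation : clear implicits.

Lemma right_translation_delta n (h x : group_pow G n) :
  right_translation h (delta x) = delta (pow_mul x (pow_inv h)).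
Proof.
by apply: (precomp_delta (s' := fun y => pow_mul y (pow_inv h))) => y;
  rewrite ?pow_mulKV ?pow_mulVK.
Qed.

Lemma diag_translation_delta n t (x : group_pow G n) :
  diag_translation n t (delta x) = delta (pow_mul (pow_diag n t) x).
Proof.
by apply: (precomp_delta (s' := pow_mul (pow_diag n t))) => y;
  rewrite ?pow_diagKV ?pow_diagVK.
Qed.

Lemma left_regularE t : left_regular t = diag_translation 0 t.
Proof. by apply/funext => f; exact: ell2P. Qed.

Lemma right_translation_commutant_vN n :
  von_neumann_algebra (commutant (range (@right_translation n))).
Proof.
apply: precomp_commutant_vN => _ [h _ <-].
by exists (fun x => pow_mul x h), (pow_rmul_bij h).
Qed.

Lemma left_regular_comm :
  range (@left_regular R G) `<=` commutant (range (@right_translation 0)).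
Proof.
move=> _ [t _ <-]; rewrite left_regularE; split; first exact: bounded_precomp.
move=> _ [h _ <-]; apply/funext => f; apply: ell2P => x.
by rewrite /= mulgA.
Qed.

(** The commutant of the right translations is a von Neumann algebra, so only generators need
    checking; an elementary tensor commutes with R_(h, k) because its legs commute with R_h and
    R_k. *)
Lemma group_vN_pow_comm n :
  @group_vN_pow R G n `<=` commutant (range (@right_translation n)).
Proof.
elim: n => [|n IH]; apply: vN_generated_sub;
  try exact: right_translation_commutant_vN; first exact: left_regular_comm.
move=> U [S [T [MS MT STU]]]; split; first by case: STU.
move=> _ [h _ <-].
have [_ Sc] : commutant (range (@right_translation 0)) S.
  exact: (vN_generated_sub (right_translation_commutant_vN 0) left_regular_comm).
have [_ Tc] := IH _ MT.
apply: tensor_comm_precomp STU (Sc _ (imageT _ h.1)) (Tc _ (imageT _ h.2)).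
by move=> [x y].
Qed.

Lemma group_vN_pow_vN n : von_neumann_algebra (@group_vN_pow R G n).
Proof.
have vM := right_translation_commutant_vN n.
have := @group_vN_pow_comm n.
by case: n vM => [|n] vM sub; apply: (vN_generated_vN vM);
  apply: subset_trans sub; exact: sub_vN_generated.
Qed.

Lemma group_vN_pow_bounded n : @group_vN_pow R G n `<=` @bounded_op R _.
Proof. exact/vN_bounded/group_vN_pow_vN. Qed.

Lemma group_vN_left_regular t : group_vN R G (left_regular t).
Proof. by apply: sub_vN_generated; exists t. Qed.

(** If c is nonzero, a finite set s carries all but less than |c|^2 of the squared norm, yet A has a
    point off s, which alone contributes |c|^2. *)
Lemma ell2_infinite_const (X : choiceType) (f : ell2 R X) (A : set X) c :
  infinite_set A -> (forall x, A x -> f x = c) -> c = 0.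
Proof.
move=> infA fc; apply: contrapT => c0; have c_gt0 : 0 < sqmod c.
  rewrite lt_neqAle sqmod_ge0 andbT eq_sym; apply/eqP => /sqmod_eq0.
  exact: c0.
have [s] := normsq_tail_lt f c_gt0; apply/negP; rewrite -leNgt.
have [x Ax xs] : exists2 x, A x & x \notin s.
  apply: contrapT => nex; apply: infA; apply: (@sub_finite_set _ _ [set` s]).
    by move=> x Ax /=; apply: contrapT => /negP xs; apply: nex; exists x.
  by apply/finite_seqP; exists s.
apply: le_trans (sqmod_le_normsq _ x); rewrite ell2B ell2_sum big1_seq ?subr0 ?fc//.
move=> y /andP[_ ys]; rewrite ell2Z deltaE; case: eqP => [xy|_]; last by rewrite mulr0.
by rewrite -xy (negbTE xs) in ys.
Qed.

Lemma icc_commutant_scalar n (T : op R (group_pow G n)) : icc G ->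
  @group_vN_pow R G n T ->
  (forall t, T \o diag_translation n t = diag_translation n t \o T) ->
  scalars _ T.
Proof.
move=> iccG MT Tdiag; have bT := group_vN_pow_bounded MT.
have [_ Tr] := group_vN_pow_comm MT.
pose one := pow_diag n (1%g : G); pose xi := T (delta one).
have xiJ x t : xi (diag_conj x t) = xi x.
  (* At x the left side is by definition the value of xi at [diag_conj x t]. *)
  suff E : diag_translation n t (right_translation (pow_diag n t) xi) = xi.
    by rewrite -[in RHS]E.
  (* Both translations are pulled inside T, where together they conjugate the identity by (t, ...,
     t) and so fix [delta one]. *)
  have /(congr1 (fun V : op R _ => V (delta one))) /= <- :=
    Tr _ (imageT _ (pow_diag n t)).
  have /(congr1 (fun V : op R _ =>
    V (right_translation (pow_diag n t) (delta one)))) /= <- := Tdiag t.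
  rewrite right_translation_delta diag_translation_delta.
  by rewrite pow_mul1 pow_diag_inv pow_diagM mulgV.
have xiE : xi = xi one *: delta one.
  apply: ell2P => x; rewrite ell2Z deltaE.
  have [->|x1] := eqVneq x one; first by rewrite mulr1.
  rewrite mulr0; apply: ell2_infinite_const (icc_diag_conj_infinite iccG x1) _.
  by move=> _ [t _ <-]; exact: xiJ.
exists (xi one) => //; apply: bounded_op_eq => // [|x].
  exact/bounded_opZ/bounded_op_id.
(* Right translations carry [delta one] to every point mass and commute with T, so xi determines
   T. *)
have -> : delta x = right_translation (pow_inv x) (delta one).
  by rewrite right_translation_delta pow_mul1 pow_invK.
have /(congr1 (fun V : op R _ => V (delta one))) /= -> := Tr _ (imageT _ (pow_inv x)).
have [lR _] : bounded_op (right_translation (pow_inv x)) by exact: bounded_precomp.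
by rewrite -/xi [in RHS]xiE (linear_opZ _ _ lR).
Qed.

(** Applied below to a list enumerating a finite conjugacy class; a list permits induction on the
    sum. *)
Definition class_sum (s : seq G) : op R G :=
  fun f => \sum_(c <- s) left_regular c f.

Lemma class_sum_in s : group_vN R G (class_sum s).
Proof.
have vM := group_vN_pow_vN 0.
elim: s => [|c s IH].
  apply: (vN_scalars vM); exists 0 => //; apply/funext => f.
  by rewrite /class_sum big_nil scale0r.
have -> : class_sum (c :: s) = left_regular c \+ class_sum s.
  by apply/funext => f; rewrite /class_sum big_cons.
by apply: (vN_add vM) => //; exact: group_vN_left_regular.
Qed.

(* A sum of left translations over a conjugation-invariant finite set is also a
   sum of right translations, hence commutes with L(G). *)
Lemma class_sum_central s U : uniq s ->
  (forall c t : G, c \in s -> (conjg c t) \in s) -> group_vN R G U ->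
  class_sum s \o U = U \o class_sum s.
Proof.
move=> us sJ MU; have [[lU _] Uc] := @group_vN_pow_comm 0 U MU.
have class_sumE f : class_sum s f = \sum_(c <- s) right_translation (n := 0) c^-1%g f.
  apply: ell2P => x; rewrite !ell2_sum.
  (* Reindexing by c |-> x c x^-1, which depends on the coordinate x, turns c^-1 x into x c^-1. *)
  rewrite (perm_big [seq conjg c x^-1%g | c <- s]) /=; last first.
    rewrite uniq_perm ?map_inj_uniq//; first exact: conjg_inj.
    move=> c; apply/idP/mapP => [cs|[d ds ->]]; last exact: sJ.
    by exists (conjg c x); [exact: sJ | rewrite conjgK].
  rewrite big_map; apply: eq_bigr => c _ /=; congr (f _).
  by rewrite -conjVg conjgE invgK !mulgA mulgVK.
apply/funext => f; rewrite /= !class_sumE (linear_op_sum _ _ lU).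
apply: eq_bigr => c _.
by have /(congr1 (fun V : op R G => V f)) /= <- := Uc _ (imageT _ (c^-1%g)).
Qed.

End GroupAlgebra.

(** * The iterated comultiplication and its relative commutant *)

Section IteratedComultiplication.
Variables (R : realType) (G : groupType).
Variables (Delta : op R G -> op R (G * G)%type)
  (Amp : forall n, op R (group_pow G n) -> op R (group_pow G n.+1)).
Hypotheses (comultD : is_comultiplication Delta)
  (ampA : is_amplification Delta Amp).

Local Notation iterD n := (@iter_comult R G Amp n).

Lemma amplification_hom n :
  normal_star_hom (@group_vN_pow R G n) (@group_vN_pow R G n.+1) (@Amp n).
Proof.
have [Amp0 AmpS] := ampA; case: n => [|n]; first by rewrite Amp0; case: comultD.
by case: (AmpS n).
Qed.

Lemma iter_comult_in n T : group_vN R G T ->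
  @group_vN_pow R G n (iterD n T).
Proof.
by move=> MT; elim: n => [//|n]; exact: (star_hom_in (amplification_hom n)).
Qed.

Lemma iter_comultD n S T : group_vN R G S -> group_vN R G T ->
  iterD n (S \+ T) = iterD n S \+ iterD n T.
Proof.
move=> MS MT; elim: n => //= n ->.
exact: (star_homD (amplification_hom n)) (iter_comult_in n MS) (iter_comult_in n MT).
Qed.

Lemma iter_comultM n S T : group_vN R G S -> group_vN R G T ->
  iterD n (S \o T) = iterD n S \o iterD n T.
Proof.
move=> MS MT; elim: n => //= n ->.
exact: (star_homM (amplification_hom n)) (iter_comult_in n MS) (iter_comult_in n MT).
Qed.

(** Homogeneity with scalar 0 at each stage; this is the empty case of [iter_comult_class_sum]. *)
Lemma iter_comult0 n : iterD n (fun=> 0) = fun=> 0.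
Proof.
elim: n => //= n ->.
have vM := group_vN_pow_vN (R := R) (G := G) n.
have M0 : @group_vN_pow R G n (fun=> 0).
  by apply: (vN_scalars vM); exists 0 => //; apply/funext => f; rewrite scale0r.
have := star_homZ (amplification_hom n) 0 M0.
rewrite (_ : (fun f => 0 *: 0) = (fun=> 0)) => [->|].
  by apply/funext => f; rewrite scale0r.
by apply/funext => f; rewrite scale0r.
Qed.

Lemma iter_comult_left_regular n t :
  iterD n (left_regular t) = @diag_translation R G n t.
Proof.
pose W n := iterD n (left_regular t).
(* The induction carries the tensor form: [Amp m.+1] is id (x) [Amp m], so it turns lambda_t (x) W_m
   into lambda_t (x) W_(m+1). *)
have WT : forall n, is_tensor_op (left_regular t) (W n) (W n.+1).
  have [Amp0 AmpS] := ampA; elim=> [|m IH].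
    by rewrite /W /= Amp0; case: comultD.
  have Mt := group_vN_left_regular (R := R) t.
  have [_ tensA] := AmpS m; exact: tensA Mt (iter_comult_in m Mt) IH.
rewrite -/(W n); elim: n => [|n IH]; first exact: left_regularE.
have [bW WE] := WT n; apply: bounded_op_eq => // [|[x y]].
  exact: bounded_precomp.
rewrite -tens_delta WE IH left_regularE !diag_translation_delta !tens_delta.
by rewrite diag_translation_delta.
Qed.

Lemma iter_comult_class_sum n s f : iterD n (class_sum s) f =
  \sum_(c <- s) @diag_translation R G n c f.
Proof.
elim: s => [|c s IH].
  rewrite big_nil (_ : class_sum [::] = fun=> 0) ?iter_comult0//.
  by apply/funext => g; rewrite /class_sum big_nil.
rewrite big_cons -IH -iter_comult_left_regular.
rewrite (_ : class_sum (c :: s) = left_regular c \+ class_sum s).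
  by rewrite iter_comultD//; [exact: group_vN_left_regular | exact: class_sum_in].
by apply/funext => g; rewrite /class_sum big_cons.
Qed.

Lemma scalars_sub_comult_commutant n : scalars _ `<=` comult_commutant Amp n.
Proof.
move=> _ [k _ <-]; have vM := group_vN_pow_vN (R := R) (G := G) n.
have Mk : @group_vN_pow R G n ( *:%R k) by apply: (vN_scalars vM); exists k.
split => //; split; first exact: group_vN_pow_bounded Mk.
move=> _ [U MU <-]; apply/funext => f /=.
have [lU _] := group_vN_pow_bounded (iter_comult_in n MU).
by rewrite (linear_opZ _ _ lU).
Qed.

Lemma icc_comult_commutant n : icc G ->
  comult_commutant Amp n = scalars (group_pow G n).
Proof.
move=> iccG; apply/seteqP; split; last exact: scalars_sub_comult_commutant.
move=> T [[bT Tc] MT]; apply: icc_commutant_scalar iccG MT _ => t.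
rewrite -iter_comult_left_regular; apply: Tc.
by exists (left_regular t) => //; exact: group_vN_left_regular.
Qed.

Lemma comult_commutant_icc n :
  comult_commutant Amp n = scalars (group_pow G n) -> icc G.
Proof.
move=> trivC g g1; apply: contrapT => /contrapT /finite_seqP[s0 s0E].
(* Without repetitions each class element enters the sum with coefficient 1. *)
pose s := undup s0.
have sP c : (c \in s) <-> exists t, c = conjg g t.
  rewrite mem_undup; have -> : (c \in s0) <-> [set` s0] c by [].
  rewrite -s0E; split=> [[t _ <-]|[t ->]]; by [exists t | exists t].
have us : uniq s := undup_uniq s0.
have sJ c t : c \in s -> conjg c t \in s.
  by move=> /sP[u ->]; apply/sP; exists (u * t)%g; rewrite conjgM.
have : comult_commutant Amp n (iterD n (class_sum s)).
  have Ms := class_sum_in (R := R) s; have Mns := iter_comult_in n Ms.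
  split=> //; split; first exact: group_vN_pow_bounded Mns.
  (* Multiplicativity of Delta^(n) transports the centrality of the class sum in L(G). *)
  move=> _ [U MU <-]; rewrite -!iter_comultM//; congr (iterD n).
  exact: class_sum_central.
(* Coefficients at (g, ..., g) of the image of the point mass at the identity: a scalar gives 0
   since g is not 1, the class sum gives 1. *)
rewrite trivC => -[k _ /(congr1 (fun V : op R _ =>
  V (delta (pow_diag n 1%g)) (pow_diag n g)))].
rewrite iter_comult_class_sum ell2Z ell2_sum deltaE.
rewrite (inj_eq (@pow_diag_inj _ n)) (negbTE g1) mulr0.
have gs : g \in s by apply/sP; exists 1%g; rewrite conjg1.
have WE c : @diag_translation R G n c (delta (pow_diag n 1%g)) (pow_diag n g) =
    (g == c)%:R.
  by rewrite diag_translation_delta pow_diagM mulg1 deltaE (inj_eq (@pow_diag_inj _ n)).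
under eq_bigr do rewrite WE.
rewrite (big_rem g)//= eqxx big1_seq ?addr0; first by move/eqP; rewrite eq_sym oner_eq0.
by move=> c /andP[_]; rewrite mem_rem_uniq// inE eq_sym => /andP[/negbTE->].
Qed.

(** Delta^(0) is the identity, so the relative commutant at n = 0 is the centre of L(G). *)
Lemma factorE : is_factor (group_vN R G) <->
  comult_commutant Amp 0 = scalars (group_pow G 0).
Proof.
have -> : comult_commutant Amp 0 = group_vN R G `&` commutant (group_vN R G).
  by rewrite /comult_commutant /= image_id setIC.
by split=> [[]//|E]; split=> //; exact: (group_vN_pow_vN 0).
Qed.

End IteratedComultiplication.

Theorem proposition6p2 (R : realType) (G : groupType)
    (Delta : op R G -> op R (G * G)%type)
    (Amp : forall n : nat, op R (group_pow G n) -> op R (group_pow G n.+1)) :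
  is_comultiplication Delta -> is_amplification Delta Amp ->
  [<-> icc G;
       is_factor (group_vN R G);
       exists n : nat, (0 < n)%N /\
         comult_commutant Amp n = scalars (group_pow G n);
       forall n : nat, (0 < n)%N ->
         comult_commutant Amp n = scalars (group_pow G n)].
Proof.
move=> comultD ampA; have icc_triv := icc_comult_commutant comultD ampA.
have triv_icc := comult_commutant_icc comultD ampA.
have factor := factorE Amp.
(* Triviality at each single n is equivalent to i.c.c.; n = 0 serves the factor condition, and n = 1
   is the witness for existence. *)
tfae.
- by move=> iccG; apply/factor/icc_triv.
- by move=> /factor /triv_icc iccG; exists 1%N; split=> //; exact: icc_triv.
- by move=> [n [_ /triv_icc iccG]] m _; exact: icc_triv.
- by move=> /(_ 1%N isT) /triv_icc.
Qed.
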